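(* Let $G$ be a finite graph whose vertex set can be partitioned into four parts such that three of them induce cliques in $G$ and the fourth one splits into two sets, each inducing a clique in $G$, with no edge of $G$ running between these two sets. Then one can assign to each vertex of $G$ a convex set in the plane such that the intersection graph of these convex sets is $G$ (two vertices are adjacent in $G$ iff their assigned sets intersect). *)

(* Defs.v *)
From mathcomp Require Import all_boot all_order all_algebra.
From mathcomp Require Import classical_sets reals convex.

Set Implicit Arguments.
Unset Strict Implicit.
Unset Printing Implicit Defensive.

(* A finite simple graph is an irreflexive symmetric relation on a finType. *)
Definition simple_graph (T : finType) (adj : rel T) : Prop :=
  irreflexive adj /\ symmetric adj.

Definition clique (T : finType) (adj : rel T) (A : {set T}) : Prop :=
  {in A &, forall x y, x != y -> adj x y}.

(* Indexed rather than a {set {set T}}, so that parts may be empty. *)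
Definition partitioned (T : finType) (k : nat) (V : 'I_k -> {set T}) : Prop :=
  (forall i j, i != j -> [disjoint V i & V j]) /\
  \bigcup_(i < k) V i = [set: T].

Definition split_into_nonadjacent_cliques
    (T : finType) (adj : rel T) (W : {set T}) : Prop :=
  exists A B : {set T},
    [/\ W = A :|: B, [disjoint A & B], clique adj A, clique adj B
      & {in A & B, forall x y, ~~ adj x y}].

(* The graphs being loopless, only pairs of distinct vertices are compared. *)
Definition is_intersection_graph
    (T : finType) (adj : rel T) (P : Type) (C : T -> set P) : Prop :=
  forall u v : T, u != v -> (adj u v <-> (C u `&` C v !=set0)%classic).

(* Main.v *)
(** The complete graph on five vertices minus an edge is planar, so five convex
    polygons, one per clique, can be placed in the plane so that every two of
    them, except those of the two halves of the fourth part, touch at a common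
    corner.  Blow up the contact point of the polygons [i < j] into a tiny
    parabolic arc bulging towards [j], with one point on it for each vertex of
    clique [j].  A vertex [u] is represented by the hull of the points attached
    to its edges, the edge joining [u] in clique [i] to [v] in clique [j] being
    given the point of [v] on the arc between [i] and [j].  If such [u] and [v]
    are not adjacent, the tangent of the arc at the point of [v] separates their
    hulls. *)
Require Import Defs.
From mathcomp Require Import all_boot all_order all_algebra.
From mathcomp Require Import ring lra.
From mathcomp Require Import classical_sets interval_inference reals convex.

Set Implicit Arguments.
Unset Strict Implicit.
Unset Printing Implicit Defensive.

Import Order.TTheory GRing.Theory Num.Theory.

(** * Integer coordinates of the touching polygons *)

(* Polygons 0, 1, 2 stand for the cliques and 3, 4 for the halves of the fourth
   part.  The diagonal values are common points of the polygon, used for the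
   edges inside a clique; polygons 3 and 4 do not touch, and [contact 3 4] is
   only a point of a line separating them. *)
Definition contact (i j : nat) : int * int :=
  match i, j with
  | 0, 0 => (-2, -1)%Z
  | 0, 1 => (0, -4)%Z
  | 0, 2 => (-3, 2)%Z
  | 0, 3 => (-1, -1)%Z
  | 0, 4 => (-6, 4)%Z
  | 1, 1 => (2, -1)%Z
  | 1, 2 => (3, 2)%Z
  | 1, 3 => (1, -1)%Z
  | 1, 4 => (6, 4)%Z
  | 2, 2 => (0, 2)%Z
  | 2, 3 => (0, 1)%Z
  | 2, 4 => (0, 3)%Z
  | 3, 4 => (0, 2)%Z
  | 4, 4 => (0, 4)%Z
  | _, _ => (0, 0)%Z
  end.

(* Normal, pointing towards [j], of a line through [contact i j] that separates
   the rest of polygon [i] from the rest of polygon [j]. *)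
Definition normal (i j : nat) : int * int :=
  match i, j with
  | 0, 1 => (1, 0)%Z
  | 0, 2 => (1, 1)%Z
  | 0, 3 => (2, 1)%Z
  | 0, 4 => (1, 2)%Z
  | 1, 2 => (-1, 1)%Z
  | 1, 3 => (-2, 1)%Z
  | 1, 4 => (-1, 2)%Z
  | 2, 3 => (0, -1)%Z
  | 2, 4 => (0, 1)%Z
  | 3, 4 => (0, 1)%Z
  | _, _ => (0, 0)%Z
  end.

Local Open Scope ring_scope.

Definition side (i j : nat) (p : int * int) : int :=
  (normal i j).1 * (p.1 - (contact i j).1) +
  (normal i j).2 * (p.2 - (contact i j).2).

(** Checked by evaluation on all quadruples; the gap of 1 is the room left for blowing up contacts
    into arcs. The point [contact 3 4] is excluded since it lies in neither polygon, but its line is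
    still tested. The default [(0, 0)] of [contact] serves as the diagonal point of polygon 3. *)
Lemma contact_side (i j k l : nat) :
    (i < j < 5)%N -> (k <= l < 5)%N -> (k, l) != (i, j) -> (k, l) != (3, 4)%N ->
  ((i == k) || (i == l) -> side i j (contact k l) <= -1) /\
  ((j == k) || (j == l) -> 1 <= side i j (contact k l)).
Proof.
case/andP=> ij j5 /andP[kl l5] neij ne34.
pose ok i j k l := [==> (i < j)%N, (k <= l)%N, (k, l) != (i, j),
    (k, l) != (3, 4)%N =>
  ((i == k) || (i == l) ==> (side i j (contact k l) <= -1)) &&
  ((j == k) || (j == l) ==> (1 <= side i j (contact k l)))].
pose s := iota 0 5.
have ins (n : nat) : (n < 5)%N -> n \in s by rewrite mem_iota.
have: all (fun i => all (fun j => all (fun k => all (ok i j k) s) s) s) s.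
  by vm_compute.
move=> /allP/(_ i (ins _ (ltn_trans ij j5)))/allP/(_ j (ins _ j5)).
move=> /allP/(_ k (ins _ (leq_ltn_trans kl l5)))/allP/(_ l (ins _ l5)).
by rewrite /ok ij kl neij ne34 => /andP[/implyP ? /implyP ?].
Qed.

Lemma contact_bound (i j : nat) :
  `|(contact i j).1| <= 6 /\ `|(contact i j).2| <= 6.
Proof. by case: i j => [|[|[|[|[|i]]]]] [|[|[|[|[|j]]]]]. Qed.

Lemma normal_bound (i j : nat) :
  `|(normal i j).1| <= 2 /\ `|(normal i j).2| <= 2.
Proof. by case: i j => [|[|[|[|[|i]]]]] [|[|[|[|[|j]]]]]. Qed.

Lemma normal_neq0 (i j : nat) :
  (i < j < 5)%N -> ((normal i j).1 != 0) || ((normal i j).2 != 0).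
Proof.
by case: i j => [|[|[|[|[|i]]]]] [|[|[|[|[|j]]]]] //=; rewrite andbF.
Qed.

(** * Parabolic arcs and their tangents *)

(* The value at [(x, y)] of the equation of the tangent, at the point of
   parameter [s], to the arc [t |-> t (- b, a) - t^2 (a, b)]. *)
Definition tangent (R : realFieldType) (a b s x y : R) : R :=
  a * x + b * y + 2 * s * (a * y - b * x) - s ^+ 2 * (a ^+ 2 + b ^+ 2).

(** A parabola lies on one side of each of its tangents and touches it only at [t = s], provided
    [(a, b)] is nonzero. *)
Lemma tangent_arc (R : realFieldType) (a b s t : R) :
  tangent a b s (- t * b - t ^+ 2 * a) (t * a - t ^+ 2 * b) =
  - ((a ^+ 2 + b ^+ 2) * (s - t) ^+ 2).
Proof. by rewrite /tangent; ring. Qed.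

Lemma ler_normM (R : realFieldType) (x y c d : R) :
  `|x| <= c -> `|y| <= d -> `|x * y| <= c * d.
Proof. by move=> xc yd; rewrite normrM ler_pM. Qed.

(** Here 2 bounds the normals and 12 the differences of contacts; with parameters up to 1/1000,
    tilting the line and moving the point cannot use up the gap of [contact_side]. *)
Lemma tangent_perturbation (R : realFieldType) (a b a' b' s t x y : R) :
    `|a| <= 2 -> `|b| <= 2 -> `|a'| <= 2 -> `|b'| <= 2 ->
    `|x| <= 12 -> `|y| <= 12 -> 0 <= s <= 1000^-1 -> 0 <= t <= 1000^-1 ->
  `|tangent a b s (x + (- t * b' - t ^+ 2 * a')) (y + (t * a' - t ^+ 2 * b'))
    - (a * x + b * y)| < 1.
Proof.
move=> ha hb ha' hb' hx hy /andP[s0 s1] /andP[t0 t1].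
have nt : `|t| <= 1000^-1 by rewrite ger0_norm.
have ns : `|s| <= 1000^-1 by rewrite ger0_norm.
set e := - t * b' - _; set f := t * a' - _.
have he : `|e| <= 1/200.
  have := ler_normM nt hb'; have := ler_normM (ler_normM nt nt) ha'.
  rewrite /e expr2 !ler_norml; lra.
have hf : `|f| <= 1/200.
  have := ler_normM nt ha'; have := ler_normM (ler_normM nt nt) hb'.
  rewrite /f expr2 !ler_norml; lra.
have hae := ler_normM ha he; have hbf := ler_normM hb hf.
have hX : `|x + e| <= 13 by move: hx he; rewrite !ler_norml; lra.
have hY : `|y + f| <= 13 by move: hy hf; rewrite !ler_norml; lra.
have h1 := ler_normM ns (ler_normM ha hY).
have h2 := ler_normM ns (ler_normM hb hX).
have h3 := ler_normM (ler_normM ns ns) (ler_normM ha ha).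
have h4 := ler_normM (ler_normM ns ns) (ler_normM hb hb).
rewrite /tangent.
have -> : a * (x + e) + b * (y + f) + 2 * s * (a * (y + f) - b * (x + e)) -
    s ^+ 2 * (a ^+ 2 + b ^+ 2) - (a * x + b * y) =
  a * e + b * f + 2 * (s * (a * (y + f))) - 2 * (s * (b * (x + e)))
  - s * s * (a * a) - s * s * (b * b) by ring.
move: hae hbf h1 h2 h3 h4.
rewrite !ler_norml ltr_norml; lra.
Qed.

Definition plane_point (R : realType) (x y : R) : 'rV[R]_2 :=
  \row_k (if k == 0 then x else y).

Definition arc_point (R : realType) (i j : nat) (t : R) : 'rV[R]_2 :=
  let a := (normal i j).1%:~R in let b := (normal i j).2%:~R in
  plane_point ((contact i j).1%:~R + (- t * b - t ^+ 2 * a))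
              ((contact i j).2%:~R + (t * a - t ^+ 2 * b)).

Definition arc_tangent (R : realType) (i j : nat) (s : R) (p : 'rV[R]_2) : R :=
  tangent (normal i j).1%:~R (normal i j).2%:~R s
    (p 0 0 - (contact i j).1%:~R) (p 0 1 - (contact i j).2%:~R).

Lemma arc_tangent_arc (R : realType) (i j : nat) (s t : R) :
  arc_tangent i j s (arc_point i j t) =
  - (((normal i j).1%:~R ^+ 2 + (normal i j).2%:~R ^+ 2) * (s - t) ^+ 2).
Proof.
rewrite -tangent_arc /arc_tangent /arc_point !mxE /=.
by congr tangent; ring.
Qed.

Lemma arc_tangent_arc_lt0 (R : realType) (i j : nat) (s t : R) :
  (i < j < 5)%N -> s != t -> arc_tangent i j s (arc_point i j t) < 0.
Proof.
move=> /normal_neq0; rewrite arc_tangent_arc oppr_lt0.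
set a := _.1; set b := _.2 => ab0 st.
apply: mulr_gt0; last by rewrite exprn_even_gt0 //= subr_eq0.
rewrite lt0r addr_ge0 ?sqr_ge0 // andbT paddr_eq0 ?sqr_ge0 //.
by rewrite !sqrf_eq0 !intr_eq0 negb_and.
Qed.

(** For [s = t = 0] the two values coincide; [tangent_perturbation] bounds the drift. *)
Lemma arc_tangent_near_side (R : realType) (i j k l : nat) (s t : R) :
    0 <= s <= 1000^-1 -> 0 <= t <= 1000^-1 ->
  `|arc_tangent i j s (arc_point k l t) - (side i j (contact k l))%:~R| < 1.
Proof.
move=> s01 t01; rewrite /arc_tangent /arc_point !mxE /= /side.
have [a2 b2] := normal_bound i j; have [a2' b2'] := normal_bound k l.
have [x6 y6] := contact_bound i j; have [x6' y6'] := contact_bound k l.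
have cast (z : int) (n : nat) : `|z| <= n%:R -> `|z%:~R : R| <= n%:R.
  by rewrite -intr_norm -[n%:R in X in _ -> X]mulrz_nat ler_int natz.
have bound12 (z z' : int) : `|z| <= 6 -> `|z'| <= 6 -> `|(z - z')%:~R : R| <= 12.
  move=> hz hz'; apply: (cast _ 12%N); apply: le_trans (ler_normB _ _) _.
  exact: lerD hz hz'.
have := tangent_perturbation (cast _ _ a2) (cast _ _ b2) (cast _ _ a2')
  (cast _ _ b2') (bound12 _ _ x6' x6) (bound12 _ _ y6' y6) s01 t01.
have shift (z z' : int) (e : R) : z%:~R + e - z'%:~R = (z - z')%:~R + e.
  by rewrite rmorphB addrAC.
by rewrite !shift [(_ * _ + _)%:~R]intrD !intrM.
Qed.

Lemma arc_tangent_arc_side (R : realType) (i j k l : nat) (s t : R) :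
    0 <= s <= 1000^-1 -> 0 <= t <= 1000^-1 ->
    (i < j < 5)%N -> (k <= l < 5)%N -> (k, l) != (i, j) -> (k, l) != (3, 4)%N ->
  ((i == k) || (i == l) -> arc_tangent i j s (arc_point k l t) < 0) /\
  ((j == k) || (j == l) -> 0 < arc_tangent i j s (arc_point k l t)).
Proof.
move=> s01 t01 ij kl neij ne34.
have [neg pos] := contact_side ij kl neij ne34.
have := arc_tangent_near_side i j k l s01 t01; rewrite ltr_norml => /andP[lo hi].
split=> [/neg|/pos]; rewrite -(ler_int R) ?rmorphN /= => ?; lra.
Qed.

(** * Half-planes, hulls and the representation *)

Local Open Scope classical_set_scope.

Lemma arc_tangent_conv (R : realType) (i j : nat) (s : R) (t : {i01 R})
    (p q : convex_lmodType 'rV[R]_2) :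
  arc_tangent i j s (conv t p q) =
  t%:num * arc_tangent i j s p + (1 - t%:num) * arc_tangent i j s q.
Proof. by rewrite /arc_tangent /tangent /conv /= !mxE /unstable.onem; ring. Qed.

Lemma convex_tangent_lt0 (R : realType) (i j : nat) (s : R) :
  convex_set [set p : 'rV[R]_2 | arc_tangent i j s p < 0].
Proof.
(* With weights strictly between 0 and 1, both summands are negative. *)
apply/convex_setW => p q /set_mem /= fp /set_mem /= fq t t0 t1.
rewrite inE /= arc_tangent_conv -(addr0 0) ltrD // pmulr_rlt0 //.
by rewrite subr_gt0.
Qed.

Lemma convex_tangent_ge0 (R : realType) (i j : nat) (s : R) :
  convex_set [set p : 'rV[R]_2 | 0 <= arc_tangent i j s p].
Proof.
move=> p q t; rewrite !inE /= arc_tangent_conv => fp fq.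
by rewrite addr_ge0 // mulr_ge0 // subr_ge0 le1.
Qed.

(** In this form, a half-plane containing the generators contains the hull at once. *)
Definition hull (R : realType) (G : set 'rV[R]_2) : set 'rV[R]_2 :=
  [set p | forall H : set 'rV[R]_2, convex_set H -> G `<=` H -> H p].

Lemma convex_hull (R : realType) (G : set 'rV[R]_2) : convex_set (hull G).
Proof.
move=> p q t /set_mem hp /set_mem hq; apply/mem_set => H cH GH.
by apply/set_mem/cH; apply/mem_set; [apply: hp|apply: hq].
Qed.

Lemma clique_classes_representation (R : realType) (T : finType)
    (adj : rel T) (cls : T -> nat) :
    symmetric adj -> (forall v, (cls v < 5)%N) ->
    (forall u v, u != v -> cls u = cls v -> adj u v) ->
    (forall u v, adj u v -> (cls u, cls v) != (3, 4)%N) ->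
  exists C : T -> set 'rV[R]_2,
    (forall v : T, convex_set (C v)) /\ is_intersection_graph adj C.
Proof.
move=> adjC cls5 adj_cls adj34.
(* The shift by 1000 keeps the parameters within the range of the perturbation bound, and the rank
   makes them distinct. *)
pose tau (v : T) : R := (1000 + enum_rank v)%:R^-1.
have tau_small v : 0 <= tau v <= 1000^-1.
  by rewrite invr_ge0 ler0n lef_pV2 ?posrE ?ltr0n ?ler_nat //= leq_addr.
have tau_inj : injective tau.
  move=> u v /invr_inj/eqP; rewrite eqr_nat eqn_add2l.
  by move=> /eqP/val_inj/enum_rank_inj.
(* Inside a class, [normal] defaults to [(0, 0)], so the arc shrinks to the diagonal contact. A
   vertex without edges gets the empty set. *)
pose gens u := [set p : 'rV[R]_2 | exists x y, [/\ adj x y, (cls x <= cls y)%N,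
  (u == x) || (u == y) & p = arc_point (cls x) (cls y) (tau y)]].
exists (fun v => hull (gens v)); split=> [v|]; first exact: convex_hull.
move=> u v neuv.
have disj x y : ~~ adj x y -> (cls x < cls y)%N ->
    ~ (hull (gens x) `&` hull (gens y) !=set0).
  move=> nxy ltxy [p [px py]].
  have xy5 : (cls x < cls y < 5)%N by rewrite ltxy cls5.
  have gens_side z w : adj z w -> (cls z <= cls w)%N ->
      (cls z, cls w) != (cls x, cls y) ->
      ((x == z) || (x == w) ->
        arc_tangent (cls x) (cls y) (tau y) (arc_point (cls z) (cls w) (tau w)) < 0) /\
      ((y == z) || (y == w) ->
        0 < arc_tangent (cls x) (cls y) (tau y) (arc_point (cls z) (cls w) (tau w))).
    move=> zw lezw neq; have lezw5 : (cls z <= cls w < 5)%N by rewrite lezw cls5.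
    have [neg pos] := arc_tangent_arc_side (tau_small y) (tau_small w) xy5 lezw5
      neq (adj34 _ _ zw).
    by split=> /orP[]/eqP e; [apply: neg|apply: neg|apply: pos|apply: pos];
      rewrite e eqxx ?orbT.
  have lt0 : arc_tangent (cls x) (cls y) (tau y) p < 0.
    apply: (px _ (@convex_tangent_lt0 R (cls x) (cls y) (tau y))) => q /=.
    case=> z [w [zw lezw xzw ->]].
    have [[zx wy]|neq] := eqVneq (cls z, cls w) (cls x, cls y); last first.
      by have [neg _] := gens_side _ _ zw lezw neq; apply: neg.
    (* On this arc, a generator of [x] has the parameter of a neighbour of [x], hence not that of
       [y]. *)
    have xz : x = z by case/orP: xzw ltxy => /eqP // ->; rewrite wy ltnn.
    rewrite zx wy; apply: arc_tangent_arc_lt0 => //.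
    by apply: contraNneq nxy => /tau_inj ->; rewrite xz.
  have : 0 <= arc_tangent (cls x) (cls y) (tau y) p.
    apply: (py _ (@convex_tangent_ge0 R (cls x) (cls y) (tau y))) => q /=.
    case=> z [w [zw lezw yzw ->]].
    have [[zx wy]|neq] := eqVneq (cls z, cls w) (cls x, cls y); last first.
      by have [_ pos] := gens_side _ _ zw lezw neq; apply/ltW/pos.
    (* On this arc, [y] only has its own point, which lies on the tangent: hence the weak
       inequality. *)
    have -> : w = y by case/orP: yzw ltxy => /eqP -> //; rewrite zx ltnn.
    by rewrite zx arc_tangent_arc subrr expr0n mulr0 oppr0.
  by rewrite leNgt lt0.
have meet x y : adj x y -> (cls x <= cls y)%N ->
    hull (gens x) `&` hull (gens y) !=set0.
  move=> xy lexy; exists (arc_point (cls x) (cls y) (tau y)); split=> H _; apply.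
    by exists x, y; rewrite eqxx.
  by exists x, y; rewrite eqxx orbT.
split=> /= [uv|CuCv].
  case/orP: (leq_total (cls u) (cls v)) => le; first exact: meet.
  by rewrite setIC; apply: meet; rewrite // adjC.
apply: contraT => nuv; case: (ltngtP (cls u) (cls v)) => [lt|gt|eq].
- by case: (disj u v).
- by case: (disj v u); rewrite ?[adj v u]adjC // setIC.
- by rewrite (adj_cls u v) in nuv.
Qed.

Theorem theorem4 (R : realType) (T : finType) (adj : rel T)
    (adj_simple : simple_graph adj) (V : 'I_4 -> {set T})
    (V_part : partitioned V)
    (V_clique : forall i : 'I_4, i != ord_max -> clique adj (V i))
    (V_split : split_into_nonadjacent_cliques adj (V ord_max)) :
  exists C : T -> set 'rV[R]_2,
    (forall v : T, convex_set (C v)) /\ is_intersection_graph adj C.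
Proof.
case: adj_simple => _ adjC; case: V_part => _ V_cover.
case: V_split => A [B [VAB _ cliqueA cliqueB nadjAB]].
have part v : exists i, v \in V i.
  have : v \in [set: T]%SET by rewrite inE.
  by rewrite -V_cover => /bigcupP[i _]; exists i.
pose idx v := xchoose (part v).
have V_idx v : v \in V (idx v) by apply: (xchooseP (part v)).
pose cls v := if idx v != ord_max then idx v : nat else if v \in A then 3 else 4.
have idx3 v : idx v != ord_max -> (idx v < 3)%N.
  by rewrite -val_eqE /= ltn_neqAle => -> /=; rewrite -ltnS.
have VB v : idx v = ord_max -> v \notin A -> v \in B.
  by have := V_idx v => /[swap] ->; rewrite VAB inE => /orP[->|].
apply: (@clique_classes_representation R T adj cls adjC) => [v|u v neuv|u v uv].
- by rewrite /cls; case: ifP => [/idx3/leq_trans->|_] //; case: ifP.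
- rewrite /cls; have [u3|u3] := eqVneq (idx u); have [v3|v3] := eqVneq (idx v).
  + case: ifPn => uA; case: ifPn => vA // _; first exact: cliqueA.
    by apply: cliqueB => //; apply: VB.
  + by have := idx3 v v3; case: (idx v) => -[|[|[|?]]] //=; case: ifP.
  + by have := idx3 u u3; case: (idx u) => -[|[|[|?]]] //=; case: ifP.
  + move=> /val_inj uv; apply: (V_clique _ u3) => //; rewrite uv.
    exact: V_idx.
(* Class 3 forces membership in [A] and class 4 in [B], and no edge joins these. *)
- rewrite /cls; apply/negP => /eqP[].
  case: ifPn => [/idx3 + eq3|/negPn/eqP u3]; first by rewrite eq3.
  case: ifPn => // uA _.
  case: ifPn => [/idx3 + eq4|/negPn/eqP v3]; first by rewrite eq4.
  case: ifPn => // vA _; have := nadjAB u v uA (VB v v3 vA).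
  by rewrite uv.
Qed.
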